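(* Let $n\ge 0$ and $m\ge 0$ be integers with $\alpha(m)\le n$. Then in $\mathcal{A}/\!\!/\mathcal{A}_n$ one has $Sq^{m+1}\in T_m$; that is, the class of $Sq^{m+1}$ in $\mathcal{A}/\!\!/\mathcal{A}_n$ lies in the image of $T_m$ under the quotient map $\mathcal{A}\to\mathcal{A}/\!\!/\mathcal{A}_n$.
   Context: $\mathcal{A}$ is the mod 2 Steenrod algebra and $\mathbf{Z}_2$ is the integers mod 2. $\mathcal{A}_n\subset\mathcal{A}$ is the subalgebra generated by $Sq^1,Sq^2,Sq^4,\ldots,Sq^{2^n}$, and $\mathcal{A}/\!\!/\mathcal{A}_n=\mathcal{A}\otimes_{\mathcal{A}_n}\mathbf{Z}_2$ is the quotient of $\mathcal{A}$ by the left ideal generated by the positive-degree elements of $\mathcal{A}_n$. $\alpha(m)$ is the number of ones in the binary expansion of $m$. For a finite sequence of positive integers $I=(i_1,\ldots,i_k)$, $Sq^I=Sq^{i_1}\cdots Sq^{i_k}$, and $I$ is admissible if $i_s\ge 2i_{s+1}$ for all $1\le s<k$ (the empty sequence is admissible, with $Sq^I=1$). $T_b\subset\mathcal{A}$ is the $\mathbf{Z}_2$-span of all admissible $Sq^I$ with $i_1\le b$ (including $1$, for the empty sequence). *)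

(* Defs.v *)
From HB Require Import structures.
From mathcomp Require Import all_boot all_order all_algebra.
From mathcomp Require Import generic_quotient ring_quotient.
From mathcomp Require Import boolp.
From mathcomp Require Import monalg.
From mathcomp Require Import zify.

Set Implicit Arguments.
Unset Strict Implicit.
Unset Printing Implicit Defensive.

Import GRing.Theory.
Local Open Scope ring_scope.
Local Open Scope quotient_scope.

Inductive span (K : pzRingType) (V : lmodType K) (X : V -> Prop) : V -> Prop :=
| span0 : span X 0
| spanD c x y : X x -> span X y -> span X (c *: x + y).

Inductive left_ideal (R : pzRingType) (X : R -> Prop) : R -> Prop :=
| left_ideal0 : left_ideal X 0
| left_idealD a x y : X x -> left_ideal X y -> left_ideal X (a * x + y).

Inductive two_sided_ideal (R : pzRingType) (X : R -> Prop) : R -> Prop :=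
| two_sided_ideal0 : two_sided_ideal X 0
| two_sided_idealD a x b y :
    X x -> two_sided_ideal X y -> two_sided_ideal X (a * x * b + y).

(* Unital subalgebra generated by X. *)
Inductive subalgebra (K : pzRingType) (A : lalgType K) (X : A -> Prop) :
    A -> Prop :=
| subalgebra_gen x : X x -> subalgebra X x
| subalgebra1 : subalgebra X 1
| subalgebraZD c x y :
    subalgebra X x -> subalgebra X y -> subalgebra X (c *: x + y)
| subalgebraM x y :
    subalgebra X x -> subalgebra X y -> subalgebra X (x * y).

Section IdealTheory.
Variables (R : pzRingType) (X : R -> Prop).

Lemma left_ideal_add x y :
  left_ideal X x -> left_ideal X y -> left_ideal X (x + y).
Proof.
elim=> [|a u v Xu _ IH] Xy; first by rewrite add0r.
by rewrite -addrA; apply: left_idealD => //; apply: IH.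
Qed.

Lemma left_idealM a x : left_ideal X x -> left_ideal X (a * x).
Proof.
elim=> [|b u v Xu _ IH]; first by rewrite mulr0; apply: left_ideal0.
by rewrite mulrDr mulrA; apply: left_idealD.
Qed.

Lemma two_sided_ideal_add x y :
  two_sided_ideal X x -> two_sided_ideal X y -> two_sided_ideal X (x + y).
Proof.
elim=> [|a u b v Xu _ IH] Xy; first by rewrite add0r.
by rewrite -addrA; apply: two_sided_idealD => //; apply: IH.
Qed.

Lemma two_sided_idealM a b x :
  two_sided_ideal X x -> two_sided_ideal X (a * x * b).
Proof.
elim=> [|c u d v Xu _ IH]; first by rewrite mulr0 mul0r; apply: two_sided_ideal0.
by rewrite mulrDr mulrDl -!mulrA !mulrA -(mulrA _ d b); apply: two_sided_idealD.
Qed.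

Lemma two_sided_ideal_gen x : X x -> two_sided_ideal X x.
Proof.
move=> Xx; rewrite -[x]addr0 -[x]mulr1 -[x]mul1r.
by apply: two_sided_idealD => //; apply: two_sided_ideal0.
Qed.

End IdealTheory.

(* The free associative Z_2-algebra with one generator for each nonnegative
   integer; the generator indexed by k stands for Sq^(k+1), and Sq^0 is 1. *)
Definition free_steenrod := {malg 'F_2[{fmonom nat}]}.
HB.instance Definition _ := GRing.Lalgebra.on free_steenrod.

Definition free_Sq (i : nat) : free_steenrod :=
  if i is k.+1 then << fmu k >> else 1.

(* The Adem relations. Below, j <= a / 2 < b, so no subtraction truncates. *)
Inductive adem : free_steenrod -> Prop :=
| Adem a b : (0 < a < 2 * b)%N ->
    adem (free_Sq a * free_Sq b -
          \sum_(j < (a./2).+1)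
             'C(b - 1 - j, a - 2 * j)%:R *: (free_Sq (a + b - j) * free_Sq j)).

Definition adem_ideal : {pred free_steenrod} :=
  fun x => `[< two_sided_ideal adem x >].

Lemma adem_idealP x : reflect (two_sided_ideal adem x) (x \in adem_ideal).
Proof. exact: asboolP. Qed.

Lemma adem_ideal_zmod : zmod_closed adem_ideal.
Proof.
split=> [|x y /adem_idealP Ix /adem_idealP Iy]; apply/adem_idealP.
  exact: two_sided_ideal0.
apply: two_sided_ideal_add => //.
by rewrite -[y]mulr1 -mulN1r mulrA; apply: two_sided_idealM.
Qed.

HB.instance Definition _ :=
  GRing.isZmodClosed.Build free_steenrod adem_ideal adem_ideal_zmod.

Lemma adem_idealM a b x : x \in adem_ideal -> a * x * b \in adem_ideal.
Proof. by move=> /adem_idealP Ix; apply/adem_idealP/two_sided_idealM. Qed.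

Lemma adem_ideal1 : (1 : free_steenrod) \notin adem_ideal.
Proof.
pose aug : {rmorphism {malg 'F_2[{fmonom nat}]} -> 'F_2}  :=
    (mcoeff (mone : {fmonom nat}) : {malg 'F_2[{fmonom nat}]} -> 'F_2).
have augSq i : (0 < i)%N -> aug (free_Sq i) = 0.
  by case: i => // k _; rewrite /aug /= mcoeffU1 fm1_eq1.
have augI x : two_sided_ideal adem x -> aug x = 0.
  elim=> [|a u b v [c d /andP[c0 cd]] _ IH]; first exact: rmorph0.
  rewrite rmorphD IH addr0 !rmorphM /= rmorphB rmorphM /= augSq // mul0r sub0r.
  rewrite raddf_sum big1 ?oppr0 ?mulr0 ?mul0r // => j _ /=.
  rewrite scaler_nat [aug _]raddfMn /= [X in X *+ _]rmorphM /= augSq ?mul0r ?mul0rn //.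
  by have := ltn_ord j; have := odd_double_half c; rewrite -muln2; case: odd; lia.
apply/negP => /adem_idealP /augI; rewrite rmorph1 => /eqP.
by rewrite oner_eq0.
Qed.

Definition steenrod := Quotient.quot (adem_ideal : zmodClosed free_steenrod).
HB.instance Definition _ := GRing.Zmodule.on steenrod.

Definition steenrod_pi (x : free_steenrod) : steenrod := \pi x.

Lemma steenrod_piE x y : (steenrod_pi x == steenrod_pi y) = (x - y \in adem_ideal).
Proof. by rewrite /steenrod_pi -Quotient.idealrBE. Qed.

Lemma steenrod_pi_surj (u : steenrod) : exists x, steenrod_pi x = u.
Proof. by exists (repr u); apply: reprK. Qed.

Lemma steenrod_piK u : steenrod_pi (repr u) = u. Proof. exact: reprK. Qed.

Lemma steenrod_pi_zmod : zmod_morphism steenrod_pi.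
Proof. by move=> x y; rewrite /steenrod_pi pi_is_zmod_morphism. Qed.
HB.instance Definition _ :=
  GRing.isZmodMorphism.Build free_steenrod steenrod steenrod_pi steenrod_pi_zmod.

Section SteenrodAlgebra.
Implicit Types (u v w : steenrod) (c d : 'F_2).

Definition steenrod_one := steenrod_pi 1.
Definition steenrod_mul u v := steenrod_pi (repr u * repr v).
Definition steenrod_scale c u := steenrod_pi (c *: repr u).

Lemma steenrod_piM x y :
  steenrod_mul (steenrod_pi x) (steenrod_pi y) = steenrod_pi (x * y).
Proof.
apply/eqP; rewrite steenrod_piE.
set x' := repr _; set y' := repr _.
have Ix : x' - x \in adem_ideal by rewrite -steenrod_piE steenrod_piK.
have Iy : y' - y \in adem_ideal by rewrite -steenrod_piE steenrod_piK.
rewrite -[x' * y'](subrK (x * y')) -mulrBl -addrA -mulrBr rpredD //.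
  by rewrite -[x' - x]mul1r adem_idealM.
by rewrite -[x * _]mulr1 adem_idealM.
Qed.

Lemma steenrod_piZ c x :
  steenrod_scale c (steenrod_pi x) = steenrod_pi (c *: x).
Proof.
apply/eqP; rewrite steenrod_piE -scalerBr.
rewrite -[_ *: _]mulr1 -[_ - _]mul1r scalerAl adem_idealM //.
by rewrite -steenrod_piE steenrod_piK.
Qed.

Let piE := (steenrod_piM, steenrod_piZ).

Lemma steenrod_mulA : associative steenrod_mul.
Proof.
by move=> u v w; rewrite -[u]steenrod_piK -[v]steenrod_piK -[w]steenrod_piK
  !piE mulrA.
Qed.
Lemma steenrod_mul1 : left_id steenrod_one steenrod_mul.
Proof. by move=> u; rewrite -[u]steenrod_piK piE mul1r. Qed.
Lemma steenrod_mulr1 : right_id steenrod_one steenrod_mul.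
Proof. by move=> u; rewrite -[u]steenrod_piK piE mulr1. Qed.
Lemma steenrod_mulDl : left_distributive steenrod_mul +%R.
Proof.
move=> u v w; rewrite -[u]steenrod_piK -[v]steenrod_piK -[w]steenrod_piK.
by rewrite -raddfD !piE mulrDl raddfD.
Qed.
Lemma steenrod_mulDr : right_distributive steenrod_mul +%R.
Proof.
move=> u v w; rewrite -[u]steenrod_piK -[v]steenrod_piK -[w]steenrod_piK.
by rewrite -raddfD !piE mulrDr raddfD.
Qed.
Lemma steenrod_one_neq0 : steenrod_one != 0.
Proof.
have <- : steenrod_pi 0 = 0 by apply: raddf0.
by rewrite steenrod_piE subr0 adem_ideal1.
Qed.

HB.instance Definition _ := GRing.Zmodule_isNzRing.Build steenrod
  steenrod_mulA steenrod_mul1 steenrod_mulr1 steenrod_mulDl steenrod_mulDr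
  steenrod_one_neq0.

Lemma steenrod_pi_monoid : monoid_morphism steenrod_pi.
Proof. by split=> // x y; rewrite -steenrod_piM. Qed.
HB.instance Definition _ :=
  GRing.isMonoidMorphism.Build free_steenrod steenrod steenrod_pi
    steenrod_pi_monoid.

Lemma steenrod_scaleA c d u :
  steenrod_scale c (steenrod_scale d u) = steenrod_scale (c * d) u.
Proof. by rewrite -[u]steenrod_piK !piE scalerA. Qed.
Lemma steenrod_scale1 : left_id 1 steenrod_scale.
Proof. by move=> u; rewrite -[u]steenrod_piK piE scale1r. Qed.
Lemma steenrod_scaleDr : right_distributive steenrod_scale +%R.
Proof.
move=> c u v; rewrite -[u]steenrod_piK -[v]steenrod_piK.
by rewrite -raddfD !piE scalerDr raddfD.
Qed.
Lemma steenrod_scaleDl u :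
  {morph steenrod_scale^~ u : c d / c + d}.
Proof. by move=> c d; rewrite -[u]steenrod_piK !piE scalerDl raddfD. Qed.

HB.instance Definition _ := GRing.Zmodule_isLmodule.Build 'F_2 steenrod
  steenrod_scaleA steenrod_scale1 steenrod_scaleDr steenrod_scaleDl.

Lemma steenrod_pi_scalable : scalable steenrod_pi.
Proof. by move=> c x; rewrite -steenrod_piZ. Qed.
HB.instance Definition _ :=
  GRing.isScalable.Build 'F_2 free_steenrod steenrod *:%R steenrod_pi
    steenrod_pi_scalable.

Lemma steenrod_scaleAl c u v : c *: (u * v) = (c *: u) * v.
Proof.
rewrite -[u]steenrod_piK -[v]steenrod_piK -rmorphM -!linearZ -rmorphM.
by rewrite scalerAl.
Qed.
HB.instance Definition _ :=
  GRing.Lmodule_isLalgebra.Build 'F_2 steenrod steenrod_scaleAl.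

Lemma steenrod_scaleAr c u v : c *: (u * v) = u * (c *: v).
Proof.
by case: c => [[|[|//]] lt_c2];
  [rewrite (_ : Ordinal _ = 0) ?scale0r ?mulr0 | rewrite (_ : Ordinal _ = 1) ?scale1r];
  rewrite //; apply: val_inj.
Qed.
HB.instance Definition _ :=
  GRing.Lalgebra_isAlgebra.Build 'F_2 steenrod steenrod_scaleAr.

End SteenrodAlgebra.

Definition Sq (i : nat) : steenrod := steenrod_pi (free_Sq i).

Lemma Sq0 : Sq 0 = 1. Proof. exact: rmorph1. Qed.

Lemma Sq_adem a b : (0 < a < 2 * b)%N ->
  Sq a * Sq b =
  \sum_(j < (a./2).+1)
     'C(b - 1 - j, a - 2 * j)%:R *: (Sq (a + b - j) * Sq j).
Proof.
move=> lt_a2b; rewrite /Sq -rmorphM.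
under eq_bigr => j _ do rewrite -rmorphM -linearZ.
rewrite -raddf_sum; apply/eqP; rewrite steenrod_piE.
by apply/adem_idealP/two_sided_ideal_gen/Adem.
Qed.

Definition Sq_seq (I : seq nat) : steenrod := \prod_(i <- I) Sq i.

(* I ranges over all sequences, admissible or not; zero entries are harmless
   since Sq 0 = 1. *)
Definition homogeneous (d : nat) : steenrod -> Prop :=
  span (fun x => exists2 I, sumn I = d & x = Sq_seq I).

(* The subalgebra A_n. *)
Definition steenrod_sub (n : nat) : steenrod -> Prop :=
  subalgebra (fun x => exists2 i, (i <= n)%N & x = Sq (2 ^ i)).

Definition steenrod_sub_pos (n : nat) (x : steenrod) : Prop :=
  steenrod_sub n x /\ exists2 d, (0 < d)%N & homogeneous d x.

(* The left ideal of A generated by the positive-degree elements of A_n. *)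
Definition sub_ideal (n : nat) : {pred steenrod} :=
  fun x => `[< left_ideal (steenrod_sub_pos n) x >].

Lemma sub_idealP n x : reflect (left_ideal (steenrod_sub_pos n) x) (x \in sub_ideal n).
Proof. exact: asboolP. Qed.

Lemma sub_idealM n a x : x \in sub_ideal n -> a * x \in sub_ideal n.
Proof. by move=> /sub_idealP hx; apply/sub_idealP/left_idealM. Qed.

Lemma sub_ideal_zmod n : zmod_closed (sub_ideal n).
Proof.
split=> [|x y /sub_idealP hx hy]; apply/sub_idealP; first exact: left_ideal0.
by apply: left_ideal_add => //; rewrite -mulN1r; apply/sub_idealP/sub_idealM.
Qed.

HB.instance Definition _ n :=
  GRing.isZmodClosed.Build steenrod (sub_ideal n) (sub_ideal_zmod n).

(* A//A_n as a left A-module. *)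
Definition steenrod_quot (n : nat) :=
  Quotient.quot (sub_ideal n : zmodClosed steenrod).
HB.instance Definition _ n := GRing.Zmodule.on (steenrod_quot n).

Definition quot_pi (n : nat) (x : steenrod) : steenrod_quot n := \pi x.

Lemma quot_piE n x y : (quot_pi n x == quot_pi n y) = (x - y \in sub_ideal n).
Proof. by rewrite /quot_pi -Quotient.idealrBE. Qed.

Section SteenrodQuotient.
Variable n : nat.
Implicit Types (a b x : steenrod) (u v : steenrod_quot n).

Lemma quot_piK u : quot_pi n (repr u) = u. Proof. exact: reprK. Qed.

Lemma quot_pi_zmod : zmod_morphism (quot_pi n).
Proof. by move=> x y; rewrite /quot_pi pi_is_zmod_morphism. Qed.
HB.instance Definition _ :=
  GRing.isZmodMorphism.Build steenrod (steenrod_quot n) (quot_pi n)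
    quot_pi_zmod.

Definition quot_scale a u : steenrod_quot n := quot_pi n (a * repr u).

Lemma quot_piM a x : quot_scale a (quot_pi n x) = quot_pi n (a * x).
Proof.
by apply/eqP; rewrite quot_piE -mulrBr sub_idealM // -quot_piE quot_piK.
Qed.

Lemma quot_scaleA a b u : quot_scale a (quot_scale b u) = quot_scale (a * b) u.
Proof. by rewrite -[u]quot_piK !quot_piM mulrA. Qed.
Lemma quot_scale1 : left_id 1 quot_scale.
Proof. by move=> u; rewrite -[u]quot_piK quot_piM mul1r. Qed.
Lemma quot_scaleDr : right_distributive quot_scale +%R.
Proof.
move=> a u v; rewrite -[u]quot_piK -[v]quot_piK.
by rewrite -raddfD !quot_piM mulrDr raddfD.
Qed.
Lemma quot_scaleDl u : {morph quot_scale^~ u : a b / a + b}.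
Proof. by move=> a b; rewrite -[u]quot_piK !quot_piM mulrDl raddfD. Qed.

HB.instance Definition _ := GRing.Zmodule_isLmodule.Build steenrod
  (steenrod_quot n) quot_scaleA quot_scale1 quot_scaleDr quot_scaleDl.

Lemma quot_piZ a x : quot_pi n (a * x) = a *: quot_pi n x.
Proof. by rewrite -quot_piM. Qed.

End SteenrodQuotient.

Definition admissible (I : seq nat) : bool :=
  all (leq 1) I && sorted (fun i j => 2 * j <= i)%N I.

Definition T (b : nat) : steenrod -> Prop :=
  span (fun x => exists2 I, admissible I && (head 0 I <= b)%N & x = Sq_seq I).

(* The number of ones in binary: bits of index >= m vanish as m < 2 ^ m. *)
Definition alpha (m : nat) : nat := (\sum_(i < m) odd (m %/ 2 ^ i))%N.

(* Main.v *)
Require Import Defs.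
From mathcomp Require Import all_boot all_order all_algebra.
From mathcomp Require Import zify.

(** The left ideal is stable under left multiplication, so if [Sq^(b+1)] is
    already congruent to some [t] in [T_b], then [Sq^a Sq^(b+1)] is congruent to
    [Sq^a t].  Two facts about the Adem relations turn this into an induction
    on [m]:

    - multiplication by [Sq^a] sends [T_b] into [T_(a+b)] ([Sq_mul_T]);
    - for [0 < a <= b], the Adem expansion of [Sq^a Sq^(b+1)] consists of
      ['C(b, a) Sq^(a+b+1)] and of admissible terms that begin at most at
      [a + b] ([Sq_adem_lead]).

    So [Sq^(m+1)] reduces to [Sq^(b+1)] as soon as [m = a + b] with [a > 0],
    ['C(b, a)] odd and [alpha b = alpha m].  Write [m = 2 a + d], where [d] is
    the block of trailing ones of [m], and put [b = a + d]: the binary digits of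
    [a] and [d] do not overlap, hence ['C(b, a)] is odd and
    [alpha b = alpha a + alpha d = alpha m].  This fails only for [a = 0], that
    is for [m + 1 = 2 ^ k] with [k = alpha m <= n] ([alpha_split]), and then
    [Sq^(m+1)] is one of the generators of [A_n], which vanishes in the
    quotient.

    The first fact is the delicate one.  After one Adem relation the terms of
    [Sq^a Sq^b Sq^I] have the form [Sq^(a+b-j) (Sq^j Sq^I)], and the bound
    [a + b] alone is not preserved when [Sq^j Sq^I] is expanded in turn.  It is
    preserved together with a second bound, [max(a, 2 b - 1)], which
    comes from the vanishing of the Adem coefficients with [b + j <= a]
    ([Sq_mul_adm]). *)

Set Implicit Arguments.
Unset Strict Implicit.
Unset Printing Implicit Defensive.

Import GRing.Theory.
Local Open Scope ring_scope.
Local Notation span := Defs.span.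

(** * Spans *)

Section Span.
Variables (K : pzRingType) (V : lmodType K).
Implicit Types (X Y : V -> Prop) (x y : V).

Lemma span_gen X x : X x -> span X x.
Proof.
by move=> Xx; rewrite -[x]scale1r -[_ *: _]addr0; apply: spanD => //; left.
Qed.

Lemma span_add X x y : span X x -> span X y -> span X (x + y).
Proof.
elim=> [|c u v Xu _ IH] Xy; first by rewrite add0r.
by rewrite -addrA; apply: spanD => //; apply: IH.
Qed.

Lemma span_scale X c x : span X x -> span X (c *: x).
Proof.
elim=> [|d u v Xu _ IH]; first by rewrite scaler0; left.
by rewrite scalerDr scalerA; apply: spanD.
Qed.

Lemma span_opp X x : span X x -> span X (- x).
Proof. by rewrite -scaleN1r; apply: span_scale. Qed.

Lemma span_sum (I : Type) (r : seq I) (P : pred I) X (F : I -> V) :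
  (forall i, P i -> span X (F i)) -> span X (\sum_(i <- r | P i) F i).
Proof. by move=> XF; elim/big_ind: _ => //; [left | apply: span_add]. Qed.

Lemma span_sub X Y x : (forall y, X y -> Y y) -> span X x -> span Y x.
Proof. by move=> sXY; elim=> [|c u v /sXY Yu _]; [left | apply: spanD]. Qed.

End Span.

Lemma span_mull (K : comPzRingType) (A : algType K) (X Y : A -> Prop) a t :
  (forall x, X x -> span Y (a * x)) -> span X t -> span Y (a * t).
Proof.
move=> XY; elim=> [|c u v Xu _ IH]; first by rewrite mulr0; left.
rewrite mulrDr -scalerAr; apply: span_add => //.
by apply: span_scale; apply: XY.
Qed.

(** * Multiplying an admissible monomial by a square *)

(** A graded piece of [T b]: the degree [d] is recorded because it drives the
    induction in [Sq_mul_adm]. *)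
Definition adm_span (b d : nat) : steenrod -> Prop :=
  span (fun x => exists2 I, [&& admissible I, (head 0%N I <= b)%N & sumn I == d]
                          & x = Sq_seq I).

Lemma adm_span_T b d x : adm_span b d x -> T b x.
Proof.
by apply: span_sub => y [I /and3P[aI hI _] ->]; exists I; rewrite ?aI.
Qed.

Lemma adm_span_le b c d x : (b <= c)%N -> adm_span b d x -> adm_span c d x.
Proof.
move=> le_bc; apply: span_sub => y [I /and3P[aI hI sI] ->]; exists I => //.
by rewrite aI sI (leq_trans hI).
Qed.

Lemma Sq_seq_cons i I : Sq_seq (i :: I) = Sq i * Sq_seq I.
Proof. by rewrite /Sq_seq big_cons. Qed.

Lemma admissible_cons i I :
  admissible (i :: I) = [&& 0 < i, 2 * head 0 I <= i & admissible I]%N.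
Proof.
rewrite /admissible /=; case: I => [|k I] /=; first by rewrite !andbT.
by case: (0 < i)%N; case: (0 < k)%N; case: (2 * k <= i)%N; case: all.
Qed.

(** With [b] the head of [I], only the case [a < 2 b] needs a relation.  Its
    terms are [Sq^(a+b-j) Sq^j Sq^I'] with [2 j <= a] and [b + j > a], and both
    multiplications are then covered by the induction on the degree of the
    right factor: [Sq^I'] has degree smaller by [b], and [Sq^j Sq^I'] has degree
    smaller by [b - j > 0].  For the heads, let [c] be the head of [I'], so that
    [2 c <= b], and let [k] be a head occurring in [Sq^j Sq^I']; the new head is
    at most [max(a + b - j, 2 k - 1)].  As [k <= j + c <= (a + b) / 2], this is
    at most [a + b]; if moreover [b <= a], then [a + b - j < 2 b] and
    [k <= max(j, 2 c - 1) <= b] bound it by [2 b - 1]. *)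
Lemma Sq_mul_adm a I : admissible I ->
  adm_span (minn (a + head 0 I) (maxn a (2 * head 0 I).-1))%N (a + sumn I)%N
           (Sq a * Sq_seq I).
Proof.
have [D] := ubnP (sumn I); elim: D => // D IHD in a I *.
move=> ltID admI; have [a0 | a_gt0] := posnP a.
  rewrite a0 Sq0 mul1r; apply: span_gen; exists I => //.
  by rewrite admI eqxx andbT /=; lia.
have [le_Ia | lt_aI] := leqP (2 * head 0 I)%N a.
  apply: span_gen; exists (a :: I); last by rewrite Sq_seq_cons.
  by rewrite admissible_cons a_gt0 le_Ia admI /= eqxx andbT; lia.
case: I => [|b I] /= in ltID admI lt_aI *; first by lia.
move: admI; rewrite admissible_cons => /and3P[b_gt0 le_Ib admI].
rewrite Sq_seq_cons mulrA Sq_adem ?a_gt0 // mulr_suml; apply: span_sum => j _.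
rewrite -scalerAl -mulrA.
(* The coefficient vanishes when [b + j <= a]. *)
have [lt_ab | le_ab] := ltnP (b - 1 - j)%N (a - 2 * j)%N.
  by rewrite bin_small // scale0r; left.
apply: span_scale.
have le_ja : (2 * j <= a)%N.
  by have := ltn_ord j; have := odd_double_half a; rewrite -muln2; lia.
apply: span_mull (IHD j I _ admI); last by lia.
move=> x [J /and3P[admJ hJ /eqP sJ] ->].
have -> : (a + (b + sumn I) = (a + b - j) + sumn J)%N by lia.
by apply: adm_span_le (IHD (a + b - j)%N J _ admJ); lia.
Qed.

Lemma Sq_mul_T a b t : T b t -> T (a + b)%N (Sq a * t).
Proof.
apply: span_mull => x [I /andP[admI hI] ->].
apply: (@adm_span_T _ (a + sumn I)%N).
by apply: adm_span_le (Sq_mul_adm a admI); lia.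
Qed.

(** * Binary digits *)

(** The summation range in [alpha] depends on its argument; a common range is
    what makes [alpha m] and [alpha m./2] comparable. *)
Lemma alpha_widen N m : (m <= N)%N ->
  alpha m = (\sum_(i < N) odd (m %/ 2 ^ i))%N.
Proof.
move=> le_mN; rewrite /alpha.
rewrite -!(big_mkord xpredT (fun i => odd (m %/ 2 ^ i) : nat)).
rewrite (@big_cat_nat _ _ _ m 0 N) //= [X in (_ + X)%N]big_nat_cond.
rewrite [X in (_ + X)%N]big1 ?addn0 // => i /andP[/andP[le_mi _] _].
by rewrite divn_small // (leq_ltn_trans le_mi) // ltn_expl.
Qed.

Lemma alpha_rec m : alpha m = (odd m + alpha m./2)%N.
Proof.
rewrite (@alpha_widen m.+1 m) // big_ord_recl expn0 divn1; congr (_ + _)%N.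
rewrite (@alpha_widen m m./2); last by lia.
by apply: eq_bigr => i _; rewrite expnS divnMA divn2.
Qed.

(** The last digit in Lucas' theorem at the prime 2, for an even upper
    index; the two parities of the lower index feed each other through Pascal's
    rule. *)
Lemma odd_bin_double n k :
  odd 'C(n.*2, k.*2) = odd 'C(n, k) /\ ~~ odd 'C(n.*2, k.*2.+1).
Proof.
elim: n k => [|n IHn] [|k]; rewrite ?bin0 ?bin0n ?doubleS //.
  by rewrite ?bin1 /= odd_double.
rewrite !binS !oddD.
have [<- /negPf->] := IHn k; have [<- /negPf->] := IHn k.+1.
rewrite doubleS; by case: odd; case: odd; case: odd.
Qed.

Lemma odd_bin_doubleS n k : odd 'C(n.*2.+1, k.*2) = odd 'C(n, k).
Proof.
case: k => [|k]; first by rewrite !bin0.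
rewrite doubleS binS oddD -doubleS.
have [-> _] := odd_bin_double n k.+1.
by have [_ /negPf->] := odd_bin_double n k; rewrite addbF.
Qed.

(** In the second case [a] is [m] without its trailing ones, halved.  The
    induction strips the last digit of [m]: a trailing 1 moves to [b], taking
    [(a, b)] to [(2 a, 2 b + 1)], and a last digit 0 allows [a = b = m / 2]. *)
Lemma alpha_split m :
  (m.+1 = 2 ^ alpha m)%N \/
  exists a b, [/\ (0 < a)%N, (a + b = m)%N, odd 'C(b, a) & alpha b = alpha m].
Proof.
have [D] := ubnP m; elim: D => // D IHD in m *; move=> lt_mD.
case m0 : (m == 0%N); first by left; rewrite (eqP m0) /alpha big_ord0.
have def_m := odd_double_half m; have def_al := alpha_rec m.
case odd_m: (odd m) in def_m def_al; last first.
  right; exists m./2, m./2; rewrite binn; split => //; lia.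
have [|m_pow | [a [b [a_gt0 def_p odd_b alpha_b]]]] := IHD m./2; first by lia.
  by left; rewrite def_al expnS -m_pow -def_m; lia.
right; exists a.*2, b.*2.+1; rewrite odd_bin_doubleS; split=> //; try lia.
by rewrite def_al -alpha_b alpha_rec /= odd_double uphalf_double.
Qed.

(** * The reduction *)

Lemma quot_pi_Sq2 n k : (k <= n)%N -> quot_pi n (Sq (2 ^ k)) = quot_pi n 0.
Proof.
move=> le_kn; apply/eqP; rewrite quot_piE subr0; apply/sub_idealP.
rewrite -[Sq _]mul1r -[_ * _]addr0; apply: left_idealD; last by left.
split; first by apply: subalgebra_gen; exists k.
exists (2 ^ k)%N; first by rewrite expn_gt0.
apply: span_gen; exists [:: 2 ^ k]%N; rewrite /= ?addn0 //.
by rewrite /Sq_seq big_seq1.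
Qed.

(** The leading term is [j = 0] of the Adem sum.  The others,
    [Sq^(a+b+1-j) Sq^j] with [1 <= j <= a / 2], are admissible as they stand,
    since [3 j <= 2 a <= a + b]. *)
Lemma Sq_adem_lead a b : (0 < a <= b)%N -> odd 'C(b, a) ->
  T (a + b)%N (Sq (a + b)%N.+1 - Sq a * Sq b.+1).
Proof.
case/andP=> a_gt0 le_ab odd_ba; rewrite Sq_adem; last by lia.
rewrite big_ord_recl /= !(muln0, subn0, subn1) /= addnS Sq0 mulr1.
have -> : 'C(b, a)%:R = 1 :> 'F_2.
  by apply: val_inj; rewrite /= val_Fp_nat //= modn2 odd_ba.
rewrite scale1r opprD addrA subrr add0r.
apply: span_opp; apply: span_sum => i _; apply/span_scale/span_gen.
have lt_i : (2 * i.+1 <= a)%N.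
  by have := ltn_ord i; have := odd_double_half a; rewrite -muln2; lia.
exists [:: ((a + b).+1 - i.+1)%N; i.+1]; last first.
  by rewrite !Sq_seq_cons /Sq_seq big_nil mulr1.
by rewrite !admissible_cons (_ : admissible [::] = true) //=; lia.
Qed.

Theorem proposition1p5 (n m : nat) (hm : (alpha m <= n)%N) :
  exists2 t : steenrod, T m t & quot_pi n (Sq m.+1) = quot_pi n t.
Proof.
have [D] := ubnP m; elim: D => // D IHD in m hm *; move=> lt_mD.
have [-> | [a [b [a_gt0 def_m odd_ba alpha_b]]]] := alpha_split m.
  by exists 0; [left | apply: quot_pi_Sq2].
have le_ab : (a <= b)%N.
  by rewrite leqNgt; apply/negP => lt_ba; rewrite bin_small in odd_ba.
have [||t Tt def_t] := IHD b; [by rewrite alpha_b | by lia |].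
have a_ab : (0 < a <= b)%N by rewrite a_gt0.
exists ((Sq m.+1 - Sq a * Sq b.+1) + Sq a * t).
  by rewrite -def_m; apply: span_add (Sq_adem_lead a_ab odd_ba) (Sq_mul_T _ Tt).
by rewrite raddfD /= quot_piZ -def_t -quot_piZ -raddfD subrK.
Qed.
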